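(* Let $m\ge 2$, $n\ge 1$ be integers, $\mathcal{A}\in T_{m,n}$ and $q\in\mathbb{R}^n$. If the system of inequalities $$ 0\le \mathcal{A}x^{m-1}+q\le \tau e-u,\quad 0\le x\le \tau^{\frac{m-2}{1-m}}u,\quad 0\le u\le \tau e,\quad \tau\ge 1, $$ in the unknowns $x\in\mathbb{R}^n$, $u\in\mathbb{R}^n$, $\tau\in\mathbb{R}$ is infeasible (has no solution $(x,u,\tau)$), then TCP$(\mathcal{A},q)$ has no solution.
   Context: $[n]=\{1,\ldots,n\}$ and $e=(1,\ldots,1)^\top\in\mathbb{R}^n$. $T_{m,n}$ is the set of all real $m$th-order $n$-dimensional tensors, i.e. arrays $\mathcal{A}=(a_{i_1\ldots i_m})$ of real numbers with $i_1,\ldots,i_m\in[n]$. For $x\in\mathbb{R}^n$, $\mathcal{A}x^{m-1}\in\mathbb{R}^n$ is the vector with components $(\mathcal{A}x^{m-1})_i=\sum_{i_2,\ldots,i_m=1}^{n}a_{ii_2\ldots i_m}x_{i_2}\cdots x_{i_m}$. Vector inequalities are componentwise. The tensor complementarity problem TCP$(\mathcal{A},q)$ is: find $x\in\mathbb{R}^n$ with $x\ge 0$, $\mathcal{A}x^{m-1}+q\ge 0$ and $x^\top(\mathcal{A}x^{m-1}+q)=0$; such an $x$ is called a solution. *)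

(* Defs.v *)
From HB Require Import structures.
From mathcomp Require Import all_boot all_order all_algebra.
From mathcomp Require Import reals exp.

Set Implicit Arguments.
Unset Strict Implicit.
Unset Printing Implicit Defensive.

Import Order.TTheory GRing.Theory Num.Theory.
Local Open Scope ring_scope.

Definition tensor (R : realType) (m n : nat) := {ffun m.-tuple 'I_n -> R}.

(* The sum ranges over the index tuples (i_1, ..., i_m) with i_1 = i; each term
   carries the factor x_(i_2) ... x_(i_m).  See [tensor_applyE] for the form
   indexed by (i_2, ..., i_m).  The value is junk (0) for m = 0. *)
Definition tensor_apply (R : realType) (m n : nat) (A : tensor R m n)
    (x : 'cV[R]_n) : 'cV[R]_n :=
  \col_i \sum_(s : m.-tuple 'I_n | ohead s == Some i)
            A s * \prod_(j <- behead s) x j 0.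

Lemma tensor_applyE (R : realType) (k n : nat) (A : tensor R k.+1 n)
    (x : 'cV[R]_n) (i : 'I_n) :
  tensor_apply A x i 0 =
  \sum_(t : k.-tuple 'I_n) A [tuple of i :: t] * \prod_(j < k) x (tnth t j) 0.
Proof.
rewrite mxE (reindex (fun t : k.-tuple 'I_n => [tuple of i :: t])) /=.
  by apply: eq_big => [t|t _]; rewrite /= ?eqxx // big_tuple.
exists (fun s : k.+1.-tuple 'I_n => [tuple of behead s]) => [t _|s].
  exact/val_inj.
rewrite inE; case/tupleP: s => j t /eqP[->].
exact/val_inj.
Qed.

Definition vec_le (R : realType) (n : nat) (x y : 'cV[R]_n) : Prop :=
  forall i, x i 0 <= y i 0.

Definition TCP_solution (R : realType) (m n : nat) (A : tensor R m n)
    (q x : 'cV[R]_n) : Prop :=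
  [/\ vec_le 0 x,
      vec_le 0 (tensor_apply A x + q)
    & (x^T *m (tensor_apply A x + q)) 0 0 = 0].

Definition TCP_system (R : realType) (m n : nat) (A : tensor R m n)
    (q x u : 'cV[R]_n) (tau : R) : Prop :=
  let e : 'cV[R]_n := const_mx 1 in
  [/\ vec_le 0 (tensor_apply A x + q) /\
        vec_le (tensor_apply A x + q) (tau *: e - u),
      vec_le 0 x /\
        vec_le x (tau `^ ((m%:R - 2) / (1 - m%:R)) *: u),
      vec_le 0 u /\ vec_le u (tau *: e)
    & 1 <= tau].

(* Main.v *)
Require Import Defs.
From mathcomp Require Import all_boot all_order all_algebra.
From mathcomp Require Import reals exp.
From mathcomp Require Import ring.

(** A solution [x] of the complementarity problem itself extends to a feasible
    point [(x, u, tau)] of the system.  Write [w] for the residual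
    [tensor_apply A x + q].  In each coordinate one of [x i], [w i] vanishes, so
    [u] can take its extreme values: [u i = 0] where [x i = 0], which leaves
    only [w i <= tau], and [u i = tau] where [x i > 0], where [w i = 0] and
    the bound on [x i] reads [x i <= tau `^ ((m - 2) / (1 - m)) * tau].  That
    right-hand side is the [(m - 1)]-th root of [tau], so it suffices that [tau]
    dominates [1], every [w i] and every [x i ^+ (m - 1)], and finitely many
    reals have a common upper bound. *)

Set Implicit Arguments.
Unset Strict Implicit.
Unset Printing Implicit Defensive.

Import Order.TTheory GRing.Theory Num.Theory.
Local Open Scope ring_scope.

(** The inner product has nonnegative terms, so it vanishes only termwise. *)
Lemma complementary_coord (R : realType) (n : nat) (x w : 'cV[R]_n) :
  vec_le 0 x -> vec_le 0 w -> (x^T *m w) 0 0 = 0 ->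
  forall i, x i 0 * w i 0 = 0.
Proof.
move=> x_ge0 w_ge0; rewrite mxE => /eqP; rewrite psumr_eq0 => [|j _].
  by move=> /allP xw0 i; have := xw0 i (mem_index_enum i); rewrite mxE => /eqP.
by rewrite mxE mulr_ge0 //; [have := x_ge0 j | have := w_ge0 j]; rewrite mxE.
Qed.

(** Since [(m - 2) / (1 - m) + 1 = 1 / (m - 1)], the bound on [a] is the
    [(m - 1)]-th root of [tau], and taking roots is monotone. *)
Lemma le_root_scaled (R : realType) (m : nat) (a tau : R) :
  (2 <= m)%N -> 0 <= a -> 0 < tau -> a ^+ m.-1 <= tau ->
  a <= tau `^ ((m%:R - 2) / (1 - m%:R)) * tau.
Proof.
case: m => [//|k] /=; rewrite ltnS => k_gt0 a_ge0 tau_gt0 le_ak.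
have k_neq0 : k%:R != 0 :> R by rewrite pnatr_eq0 -lt0n.
have expE : (k.+1%:R - 2) / (1 - k.+1%:R) + 1 = k%:R^-1 :> R.
  have -> : k.+1%:R = k%:R + 1 :> R by rewrite -addn1 natrD.
  have -> : 1 - (k%:R + 1) = - k%:R :> R by ring.
  by field.
have tau_ge0 := ltW tau_gt0.
rewrite -[X in _ * X]powRr1 // -powRD; last first.
  by rewrite (gt_eqF tau_gt0) implybT.
rewrite expE -[leLHS]powRr1 // -[X in a `^ X](mulfV k_neq0).
rewrite powRrM powR_mulrn //.
by rewrite ge0_ler_powR ?invr_ge0 ?nnegrE ?exprn_ge0.
Qed.

Theorem theorem3 (R : realType) (m n : nat) (hm : (2 <= m)%N) (hn : (1 <= n)%N)
    (A : tensor R m n) (q : 'cV[R]_n) :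
  ~ (exists (x u : 'cV[R]_n) (tau : R), TCP_system A q x u tau) ->
  ~ (exists x : 'cV[R]_n, TCP_solution A q x).
Proof.
move=> infeasible [x [x_ge0 w_ge0 xw0]]; apply: infeasible.
have compl := complementary_coord x_ge0 w_ge0 xw0.
(* An opaque [w] keeps [mxE] from expanding its entries below. *)
set w := tensor_apply A x + q in w_ge0 compl.
have wE : tensor_apply A x + q = w by []; clearbody w.
have x0 i : 0 <= x i 0 by have := x_ge0 i; rewrite mxE.
have w0 i : 0 <= w i 0 by have := w_ge0 i; rewrite mxE.
pose b i := w i 0 + x i 0 ^+ m.-1.
have b0 i : 0 <= b i by rewrite addr_ge0 ?exprn_ge0.
(* Any common upper bound of [1] and the [b i] would do. *)
pose tau : R := 1 + \sum_i b i.
have tau_ge1 : 1 <= tau by rewrite lerDl sumr_ge0.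
have tau_gt0 : 0 < tau := lt_le_trans ltr01 tau_ge1.
have b_tau i : b i <= tau.
  rewrite /tau (bigD1 i) //= addrCA lerDl addr_ge0 //.
  by rewrite sumr_ge0.
have w_tau i : w i 0 <= tau.
  by apply: le_trans (b_tau i); rewrite lerDl exprn_ge0.
have x_tau i : x i 0 ^+ m.-1 <= tau.
  by apply: le_trans (b_tau i); rewrite lerDr.
exists x, (\col_i (if x i 0 == 0 then 0 else tau)), tau.
split=> //; split=> // i; rewrite ?wE !mxE ?mulr1 //.
- case: (eqVneq (x i 0) 0) => [_|xi0]; first by rewrite subr0.
  by have /eqP := compl i; rewrite mulf_eq0 (negPf xi0) subrr => /eqP ->.
- case: (eqVneq (x i 0) 0) => [->|_]; first by rewrite mulr0.
  exact: le_root_scaled.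
- by case: ifP => // _; exact: ltW.
- by case: ifP => // _; exact: ltW.
Qed.
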